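(* Let $n\ge2$. For every simple (undirected, loopless) quantum graph on $M_n$ of the form $X_{A,\cdot,C}$ we have $\alpha(X_{A,\cdot,C})=\alpha(\mathfrak G(A,C))$, where the right-hand side is the usual independence number of the strange graph (two vertices being adjacent if joined by a classical or a strange edge).
   Context: $M_n=M_n(\mathbb C)$, with matrix units $E_{ij}$; ''projector'' means orthogonal projector. For $A,C\in M_n$ with zero diagonal, $$X_{A,\cdot,C}(x)=\sum_{i\ne j}A_{ij}\,x_{jj}E_{ii}+\sum_{i\neq j}C_{ij}\,x_{ji}E_{ij}.$$ A quantum graph on $M_n$ is a linear map $G\colon M_n\to M_n$ with $\sum_{k} G(E_{ik})G(E_{kj})=G(E_{ij})$ for all $i,j$ and $G(x^\dagger)=G(x)^\dagger$; it is undirected if self-adjoint for $\langle x,y\rangle=\mathrm{Tr}(x^\dagger y)$, and loopless if $\sum_k G(E_{ik})E_{kj}=0$ for all $i,j$. (Equivalently for $X_{A,\cdot,C}$: $A=A^T$ and $X_{ij}:=\begin{pmatrix} A_{ij} & C_{ij} \\ C_{ji} & A_{ji} \end{pmatrix}$ is a projector for all $i\neq j$.) Each such $X_{ij}$ ($i<j$) is $0$, $I$, or $\frac12\begin{pmatrix} 1 & e^{\mathrm i\theta} \\ e^{-\mathrm i\theta} & 1 \end{pmatrix}$ with $\theta\in[0,2\pi)$. The strange graph $\mathfrak G(A,C)$ is the undirected graph on $\{1,\dots,n\}$ with a classical edge $\{i,j\}$ when $X_{ij}=I$, a strange edge $\{i,j\}$ ($i<j$) of phase $\theta$ when $X_{ij}=\frac12\begin{pmatrix}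 1 & e^{\mathrm i\theta} \\ e^{-\mathrm i\theta} & 1 \end{pmatrix}$, and no edge when $X_{ij}=0$. The realignment $G^R$ of a linear map $G$ on $M_n$ is defined by $(G^R)_{(a,b),(c,d)}=G_{(d,b),(c,a)}$, where $G_{(a,b),(c,d)}$ is the coefficient of $E_{ab}$ in $G(E_{cd})$; $G$ is a quantum graph iff $G^R$ is a projector, and the operator space of $G$ is $S=\operatorname{img}G^R\subseteq M_n$. For an undirected, loopless quantum graph $X_{A,\cdot,C}$ (that is, $A,C$ have zero diagonal, $A=A^T$, and every $X_{ij}$ with $i\ne j$ is a projector), $S$ is the image of $x\mapsto\sum_{i\ne j}(A_{ij}x_{ij}+C_{ij}x_{ji})E_{ij}$. A $k$-independent set of a quantum graph is a projector $P\in M_n$ of rank $k$ with $PSP\subseteq\mathbb CP$; $\alpha$ is the largest such $k$. *)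

(* Defs.v *)
From HB Require Import structures.
From mathcomp Require Import all_boot all_order all_algebra.
From mathcomp Require Import complex.
From mathcomp Require Import boolp reals trigo.

Set Implicit Arguments.
Unset Strict Implicit.
Unset Printing Implicit Defensive.
Import Order.TTheory GRing.Theory Num.Theory.

Local Open Scope ring_scope.
Local Open Scope sesquilinear_scope.
Local Open Scope complex_scope.

(* Complex numbers are R[i] for an arbitrary real number structure R : realType;
   M ^t* is the conjugate transpose and delta_mx i j the matrix unit E_ij.
   Indices run over 'I_n = {0, ..., n - 1}. *)

Section QuantumGraphs.
Variables (R : realType) (n : nat).
Local Notation M_n := 'M[R[i]]_n.

Definition projector m (P : 'M[R[i]]_m) : Prop := P ^t* = P /\ P *m P = P.

Definition quantum_graph (G : {linear M_n -> M_n}) : Prop :=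
  (forall i j : 'I_n,
     \sum_(k < n) G (delta_mx i k) *m G (delta_mx k j) = G (delta_mx i j))
  /\ (forall x : M_n, G (x ^t*) = (G x) ^t*).

Definition undirected (G : {linear M_n -> M_n}) : Prop :=
  forall x y : M_n, \tr (x ^t* *m G y) = \tr ((G x) ^t* *m y).

Definition loopless (G : {linear M_n -> M_n}) : Prop :=
  forall i j : 'I_n, \sum_(k < n) G (delta_mx i k) *m delta_mx k j = 0.

Definition simple_quantum_graph (G : {linear M_n -> M_n}) : Prop :=
  [/\ quantum_graph G, undirected G & loopless G].

Definition coef (G : {linear M_n -> M_n}) (a b c d : 'I_n) : R[i] :=
  G (delta_mx c d) a b.

(* The linear map with matrix (G^R)_{(a,b),(c,d)} = G_{(d,b),(c,a)}. *)
Definition realignment (G : {linear M_n -> M_n}) (x : M_n) : M_n :=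
  \matrix_(a < n, b < n)
    \sum_(c < n) \sum_(d < n) coef G d b c a * x c d.

Definition in_operator_space (G : {linear M_n -> M_n}) (s : M_n) : Prop :=
  exists x : M_n, s = realignment G x.

Definition quantum_independent_set (G : {linear M_n -> M_n}) (k : nat)
    (P : M_n) : Prop :=
  [/\ projector P, \rank P = k &
      forall s : M_n, in_operator_space G s ->
        exists c : R[i], P *m s *m P = c *: P].

(* The rank of P is at most n, so k < n.+1 covers all possible ranks. *)
Definition quantum_independence_number (G : {linear M_n -> M_n}) : nat :=
  \max_(k < n.+1 | `[< exists P, quantum_independent_set G k P >]) k.

Definition X_AC (A C : M_n) (x : M_n) : M_n :=
  \sum_(i < n) \sum_(j < n | i != j) (A i j * x j j) *: delta_mx i i
  + \sum_(i < n) \sum_(j < n | i != j) (C i j * x j i) *: delta_mx i j.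

Lemma X_AC_is_linear (A C : M_n) : linear (X_AC A C).
Proof.
move=> a x y; rewrite /X_AC scalerDr addrACA !scaler_sumr.
congr (_ + _); rewrite -big_split /=; apply: eq_bigr => i _;
  rewrite scaler_sumr -big_split; apply: eq_bigr => j _;
  by rewrite !mxE mulrDr scalerDl scalerA mulrCA.
Qed.

HB.instance Definition _ (A C : M_n) :=
  GRing.isLinear.Build R[i] M_n M_n *:%R (X_AC A C) (X_AC_is_linear A C).

End QuantumGraphs.

Section StrangeGraphs.
Variable R : realType.

(* An edge {i, j} with i < j is recorded at the ordered pair (i, j); the phase
   of a strange edge refers to this order. *)
Record strange_graph (n : nat) := StrangeGraph {
  classical_edge : 'I_n -> 'I_n -> Prop;
  strange_edge : 'I_n -> 'I_n -> R -> Prop }.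

Definition adjacent n (g : strange_graph n) (i j : 'I_n) : Prop :=
  [\/ classical_edge g i j, classical_edge g j i,
      exists theta, strange_edge g i j theta |
      exists theta, strange_edge g j i theta].

Definition independent_set n (g : strange_graph n) (W : {set 'I_n}) : Prop :=
  forall i j, i \in W -> j \in W -> ~ adjacent g i j.

Definition independence_number n (g : strange_graph n) : nat :=
  \max_(W : {set 'I_n} | `[< independent_set g W >]) #|W|.

Definition mx2 (a b c d : R[i]) : 'M[R[i]]_2 :=
  block_mx a%:M b%:M c%:M d%:M : 'M_(1 + 1).

Definition X_block n (A C : 'M[R[i]]_n) (i j : 'I_n) : 'M[R[i]]_2 :=
  mx2 (A i j) (C i j) (C j i) (A j i).

Definition phase_block (theta : R) : 'M[R[i]]_2 :=
  2^-1 *: mx2 1 (cos theta +i* sin theta) (cos theta -i* sin theta) 1.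

Definition strange_graph_of n (A C : 'M[R[i]]_n) : strange_graph n :=
  StrangeGraph
    (fun i j => (i < j)%N /\ X_block A C i j = 1%:M)
    (fun i j theta => [/\ (i < j)%N, 0 <= theta < 2 * pi
                        & X_block A C i j = phase_block theta]).

End StrangeGraphs.

(* Main.v *)
(* If P is an independent projector, row i of P s P = c P for the element
   s = A_ji E_ij + C_ji E_ji of S reads
     A_ji P_ii row_j P + C_ji P_ij row_i P = c row_i P,
   so A_ji = 0 as soon as rows i and j of P are linearly independent (P_ii is
   the squared norm of row i).  Hence the indices of a maximal free family of
   rows of P form an independent set of size rank P.  Conversely, the coordinate
   projector onto an independent set of vertices compresses S to 0. *)
Require Import Defs.
From mathcomp Require Import all_boot all_order all_algebra.
From mathcomp Require Import complex.
From mathcomp Require Import boolp reals trigo.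
From mathcomp Require Import ring.

Set Implicit Arguments.
Unset Strict Implicit.
Unset Printing Implicit Defensive.
Import Order.TTheory GRing.Theory Num.Theory.

Local Open Scope complex_scope.
Local Open Scope ring_scope.
Local Open Scope sesquilinear_scope.

(** * Entries of [X_AC] and of its realignment *)

Lemma X_ACE (R : realType) n (A C : 'M[R[i]]_n) x a b :
  (forall i, A i i = 0) -> (forall i, C i i = 0) ->
  X_AC A C x a b = (\sum_j A a j * x j j) *+ (a == b) + C a b * x b a.
Proof.
(* The zero diagonals of [A] and [C] let the restriction [i != j] be dropped from both sums. *)
move=> A0 C0; rewrite /X_AC mxE !summxE; congr (_ + _).
  rewrite (bigD1 a) //= [X in _ + X]big1 ?addr0 => [|i /negbTE ia]; last first.
    by rewrite summxE big1 // => j _; rewrite !mxE [a == i]eq_sym ia mulr0.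
  rewrite summxE [in RHS](bigD1 a) //= A0 mul0r add0r -sumrMnl.
  apply: eq_big => j; first by rewrite eq_sym.
  by rewrite !mxE eqxx [b == a]eq_sym mulr_natr.
rewrite (bigD1 a) //= [X in _ + X]big1 ?addr0 => [|i /negbTE ia]; last first.
  by rewrite summxE big1 // => j _; rewrite !mxE [a == i]eq_sym ia mulr0.
have [<-|ab] := eqVneq a b.
  rewrite C0 mul0r summxE big1 // => j aj.
  by rewrite !mxE [a == j](negbTE aj) andbF mulr0.
rewrite summxE (bigD1 b) //= big1 => [|j /andP[_ /negbTE jb]].
  by rewrite !mxE !eqxx mulr1 addr0.
by rewrite !mxE [b == j]eq_sym jb andbF mulr0.
Qed.

(** Realignment turns the action of [A] on the diagonal into entrywise multiplication, which makes
    the operator space explicit. [A] enters transposed because its symmetry is not assumed here. *)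
Lemma realignment_X_AC (R : realType) n (A C : 'M[R[i]]_n) x a b :
  (forall i, A i i = 0) -> (forall i, C i i = 0) ->
  realignment (X_AC A C) x a b = A b a * x a b + C a b * x b a.
Proof.
move=> A0 C0; rewrite mxE /coef.
under eq_bigr do under eq_bigr do rewrite X_ACE // mulrDl.
under eq_bigr do rewrite big_split /=.
rewrite big_split /=; congr (_ + _).
  rewrite (bigD1 a) //= [X in _ + X]big1 ?addr0 => [|c /negbTE ca].
    rewrite (bigD1 b) //= [X in _ + X]big1 ?addr0 => [|d /negbTE ->].
      rewrite eqxx (bigD1 a) //= big1 ?addr0 => [|j /negbTE ja].
        by rewrite !mxE eqxx mulr1.
      by rewrite !mxE ja mulr0.
    by rewrite mulr0n mul0r.
  rewrite big1 // => d _; rewrite big1 ?mul0rn ?mul0r // => j _.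
  by rewrite !mxE -(eq_sym c); have [<-|] := eqVneq c j;
    rewrite ?ca ?mulr0.
rewrite (bigD1 b) //= [X in _ + X]big1 ?addr0 => [|c /negbTE cb].
  rewrite (bigD1 a) //= [X in _ + X]big1 ?addr0 => [|d /negbTE da].
    by rewrite !mxE !eqxx mulr1.
  by rewrite !mxE da andbF mulr0 mul0r.
by rewrite big1 // => d _; rewrite !mxE [b == c]eq_sym cb mulr0 mul0r.
Qed.

(** * The 2 x 2 blocks and the edges they encode *)

Lemma mx2_inj (R : realType) (a b c d a' b' c' d' : R[i]) :
  mx2 a b c d = mx2 a' b' c' d' -> [/\ a = a', b = b', c = c' & d = d'].
Proof.
have e (x y : R[i]) : x%:M = y%:M :> 'M_1 -> x = y.
  by move=> /matrixP/(_ 0 0); rewrite !mxE eqxx !mulr1n.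
by case/(@eq_block_mx _ 1 1 1 1)=> /e -> /e -> /e -> /e ->.
Qed.

Lemma mx2_1 (R : realType) : 1%:M = mx2 1 0 0 1 :> 'M[R[i]]_2.
Proof. by rewrite (scalar_mx_block 1 1) /mx2 !raddf0. Qed.

Lemma phase_blockE (R : realType) (t : R) :
  phase_block t = mx2 2^-1 (2^-1 * (cos t +i* sin t))
                    (2^-1 * (cos t -i* sin t)) 2^-1.
Proof.
rewrite /phase_block /mx2 [LHS](@scale_block_mx _ 1 1 1 1).
by rewrite !scale_scalar_mx mulr1.
Qed.

(** The block of an edge has diagonal entries 1 or 1/2. [A j i] is the coefficient of [x i j] in the
    realignment. *)
Lemma adjacent_coefs (R : realType) n (A C : 'M[R[i]]_n) i j :
  adjacent (strange_graph_of A C) i j -> i != j /\ A j i != 0.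
Proof.
have h : 2^-1 != 0 :> R[i] by rewrite invr_eq0 pnatr_eq0.
have ltneq (k l : 'I_n) : (k < l)%N -> k != l /\ l != k.
  by move=> kl; rewrite [l == k]eq_sym -val_eqE neq_ltn kl.
case=> [[/ltneq[lt gt]]|[/ltneq[lt gt]]|
        [t [/ltneq[lt gt] _]]|[t [/ltneq[lt gt] _]]];
  rewrite /X_block ?mx2_1 ?phase_blockE => /mx2_inj[e1 _ _ e2];
  by rewrite ?lt ?gt ?e1 ?e2 ?oner_eq0.
Qed.

Lemma unit_circle_angle (R : realType) (x y : R) : x ^+ 2 + y ^+ 2 = 1 ->
  exists t, [/\ 0 <= t < 2 * pi, cos t = x & sin t = y].
Proof.
move=> xy1.
have x1 : -1 <= x <= 1.
  rewrite -ler_norml -(@expr_le1 _ 2) // real_normK ?num_real //.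
  by rewrite -xy1 lerDl sqr_ge0.
have sacos : sin (acos x) = `|y|.
  by rewrite sin_acos // -xy1 addrAC subrr add0r sqrtr_sqr.
have piR := pi_gt0 R.
have [y0|y0] := leP 0 y.
  exists (acos x); rewrite acosK // sacos ger0_norm //; split=> //.
  rewrite acos_ge0 //= (le_lt_trans (acos_lepi x1)) //.
  by rewrite mulr_natl mulr2n ltrDl.
(* For [y < 0] the angle is [2 * pi - acos x]; [x < 1] makes [acos x] positive, so this stays
   strictly below [2 * pi]. *)
have xlt1 : x < 1.
  rewrite lt_neqAle; case/andP: (x1) => _ ->; rewrite andbT.
  apply: contraTneq y0 => xe; move/eqP: xy1.
  rewrite xe expr1n eq_sym addrC -subr_eq subrr eq_sym sqrf_eq0 => /eqP ->.
  by rewrite ltxx.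
exists (pi *+ 2 - acos x); split.
- rewrite mulr_natl subr_ge0 gtrDl oppr_lt0 acos_gt0 ?andbT; last first.
    by case/andP: x1 => ->.
  by rewrite (le_trans (acos_lepi x1)) // mulr2n lerDl ltW.
- by rewrite cosB cos2pi sin2pi mul1r mul0r addr0 acosK.
- rewrite sinB cos2pi sin2pi mul0r mul1r sub0r sacos ltr0_norm //.
  by rewrite opprK.
Qed.

(** The hypotheses are the first row of the idempotence of the block. If [c = 0], then [a] is 0 or
    1. Otherwise the second equation forces [a = 1/2], and the first then puts [2 * c] on the unit
    circle. *)
Lemma mx2_projector_cases (R : realType) (a c : R[i]) :
  a * a + c * c^* = a -> a * c + c * a = c ->
  [\/ a = 0 /\ c = 0, mx2 a c c^* a = 1%:M |
     exists2 t, 0 <= t < 2 * pi & mx2 a c c^* a = phase_block t].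
Proof.
move=> aa ac; have [c0|c0] := eqVneq c 0.
  move: aa; rewrite c0 mul0r addr0 => /eqP.
  rewrite -subr_eq0 -{3}[a]mulr1 -mulrBr mulf_eq0 subr_eq0.
  by case/orP=> /eqP ->; [constructor 1|constructor 2; rewrite mx2_1 rmorph0].
have a2 : a = 2^-1.
  by apply: (mulfI c0); rewrite -[in RHS]ac; field.
constructor 3.
have [w cw] : exists w, c = 2^-1 * w.
  by exists (2 * c); rewrite mulKf // pnatr_eq0.
have cJ : c^* = 2^-1 * w^* by rewrite cw rmorphM fmorphV rmorph_nat.
have : w * w^* = 1.
  have -> : w * w^* = 4 * (a * a + c * c^* - a * a) by rewrite cJ cw; field.
  by rewrite aa a2; field.
rewrite {}cJ {}cw {aa ac c0}; case: w => x y /eqP.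
rewrite eq_complex /= => /andP[/eqP xy1 _].
have [|t [t2 tx ty]] := @unit_circle_angle _ x y; first by rewrite -xy1; ring.
by exists t => //; rewrite phase_blockE a2 tx ty.
Qed.

(** * From the quantum graph axioms to the blocks *)

Lemma X_AC_delta (R : realType) n (A C : 'M[R[i]]_n) a b c d :
  (forall i, A i i = 0) -> (forall i, C i i = 0) ->
  X_AC A C (delta_mx c d) a b =
    A a c *+ (c == d) *+ (a == b) + C a b *+ ((b == c) && (a == d)).
Proof.
move=> A0 C0; rewrite X_ACE // !mxE mulr_natr; congr (_ *+ _ + _).
rewrite (bigD1 c) //= big1 ?addr0 => [|j /negbTE jc].
  by rewrite !mxE eqxx mulr_natr.
by rewrite !mxE jc mulr0.
Qed.

(** Each axiom is tested on matrix units: compatibility with the adjoint at E_ji and E_jj makes [C]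
    Hermitian and [A] real, self-adjointness then makes [A] symmetric, and the product identity at
    E_jj and E_ji gives the two idempotence equations. *)
Lemma simple_X_AC_coefs (R : realType) n (A C : 'M[R[i]]_n) i j :
  (forall i, A i i = 0) -> (forall i, C i i = 0) ->
  simple_quantum_graph (X_AC A C) -> i != j ->
  [/\ A j i = A i j, C j i = (C i j)^*,
      A i j * A i j + C i j * (C i j)^* = A i j &
      A i j * C i j + C i j * A i j = C i j].
Proof.
move=> A0 C0 [[Gproj GH] Gsym _] ij.
have ji : (j == i) = false by rewrite eq_sym (negbTE ij).
have adjE (M : 'M[R[i]]_n) a b : (M ^t*) a b = (M b a)^* by rewrite !mxE.
have deltaH k l : (delta_mx k l : 'M[R[i]]_n) ^t* = delta_mx l k.
  by apply/matrixP => a b; rewrite !mxE rmorph_nat andbC.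
(* The second factor of [\sum_c G (E_kc) *m G (E_cl)] has the coefficients of
   G^R, whose closed form turns the double sum into two terms. *)
have projE k l a b : X_AC A C (delta_mx k l) a b =
    A b l * X_AC A C (delta_mx k l) a b + C l b * X_AC A C (delta_mx k b) a l.
  pose x := \matrix_(c, d) X_AC A C (delta_mx k c) a d.
  have := realignment_X_AC x l b A0 C0; rewrite [x l b]mxE [x b l]mxE => <-.
  rewrite -Gproj summxE mxE; apply: eq_bigr => c _.
  by rewrite mxE; apply: eq_bigr => d _; rewrite mulrC [x c d]mxE.
have CH : C j i = (C i j)^*.
  have /matrixP/(_ j i) := GH (delta_mx j i).
  rewrite deltaH adjE /= !X_AC_delta // !eqxx ji (negbTE ij) /=.
  by rewrite !mulr0n !add0r.
have Areal : A i j = (A i j)^*.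
  have /matrixP/(_ i i) := GH (delta_mx j j).
  rewrite deltaH adjE /= !X_AC_delta // !eqxx (negbTE ij) /=.
  by rewrite !addr0.
have AT : A j i = A i j.
  have tr_delta (M : 'M[R[i]]_n) k : \tr (delta_mx k k *m M) = M k k.
    rewrite /mxtrace (bigD1 k) //= big1 ?addr0 => [|l /negbTE lk].
      rewrite mxE (bigD1 k) //= big1 ?addr0 => [|l /negbTE lk].
        by rewrite mxE !eqxx mul1r.
      by rewrite mxE lk andbF mul0r.
    by rewrite mxE big1 // => m _; rewrite mxE lk mul0r.
  have := Gsym (delta_mx j j) (delta_mx i i).
  rewrite [RHS]mxtrace_mulC deltaH !tr_delta adjE /= !X_AC_delta //.
  by rewrite !eqxx ji (negbTE ij) /= !addr0 !mulr1n -Areal.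
split=> //.
  have := projE j j i i; rewrite !X_AC_delta // !eqxx ji (negbTE ij) /=.
  by rewrite !addr0 !mulr0n !add0r CH [_^* * _]mulrC => <-.
have := projE j i i j; rewrite !X_AC_delta // !eqxx ji (negbTE ij) /=.
by rewrite !mulr0n !add0r !addr0 AT => <-.
Qed.

Lemma nonadjacent_coefs (R : realType) n (A C : 'M[R[i]]_n) i j :
  (forall i, A i i = 0) -> (forall i, C i i = 0) ->
  simple_quantum_graph (X_AC A C) ->
  i != j -> ~ adjacent (strange_graph_of A C) i j -> A i j = 0 /\ C i j = 0.
Proof.
(* Edges are recorded at pairs [i < j] only; the other order follows from the symmetry of [A] and
   the hermiticity of [C]. *)
move=> A0 C0 G; wlog ij : i j / (i < j)%N => [wl|] ne nadj.
  have [ij|ji|/val_inj e] := ltngtP i j; first exact: wl.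
    have [AT CH _ _] := simple_X_AC_coefs A0 C0 G ne.
    have [] := wl j i ji; first by rewrite eq_sym.
      by case=> h; apply: nadj;
        [constructor 2|constructor 1|constructor 4|constructor 3].
    by rewrite AT CH => -> /eqP; rewrite conjC_eq0 => /eqP.
  by rewrite e eqxx in ne.
have [AT CH e1 e2] := simple_X_AC_coefs A0 C0 G ne.
have [//|e|[t t2 e]] := mx2_projector_cases e1 e2; case: nadj.
  by constructor 1; split; rewrite // /X_block CH AT.
by constructor 3; exists t; split; rewrite // /X_block CH AT.
Qed.

(** * Linear algebra of projectors *)

Lemma projector_diag_neq0 (R : realType) n (P : 'M[R[i]]_n) i :
  projector P -> row i P != 0 -> P i i != 0.
Proof.
move=> [PH PP]; apply: contra => /eqP Pii.
have: \sum_k `|P i k| ^+ 2 = 0.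
  rewrite -[RHS]Pii -[in RHS]PP mxE; apply: eq_bigr => k _.
  by rewrite normCK; congr (_ * _); rewrite -[in RHS]PH !mxE.
move=> /eqP; rewrite psumr_eq0 => [|k _]; last exact: exprn_ge0.
move=> /allP P0; apply/eqP/rowP => k; rewrite !mxE; apply/eqP.
by have := P0 k (mem_index_enum k); rewrite sqrf_eq0 normr_eq0.
Qed.

Lemma independent_rows_coef (R : realType) n (P s : 'M[R[i]]_n) i j c :
  projector P -> i != j ->
  (forall a b, a *: row i P + b *: row j P = 0 -> a = 0 /\ b = 0) ->
  (forall k l, s k l != 0 -> (k, l) = (i, j) \/ (k, l) = (j, i)) ->
  P *m s *m P = c *: P -> s i j = 0.
Proof.
move=> projP ij free supp /(congr1 (row i)).
have rowPs : row i (P *m s) =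
    (P i i * s i j) *: delta_mx 0 j + (P i j * s j i) *: delta_mx 0 i.
  apply/rowP => l; rewrite !mxE.
  rewrite (bigD1 i) //= (bigD1 j) 1?eq_sym //= big1 ?addr0 => [|k].
    congr (_ + _); have [->|lj] := eqVneq l _; rewrite ?mulr1 ?mulr0 //;
    apply/eqP; rewrite mulf_eq0; apply/orP; right; apply: contraT => /supp;
    by case=> -[*]; move: lj ij; subst; rewrite eqxx.
  case/andP => ki kj.
  have [->|/supp] := eqVneq (s k l) 0; first by rewrite mulr0.
  by case=> -[*]; move: ki kj; subst; rewrite eqxx.
rewrite row_mul rowPs mulmxDl -!scalemxAl -!rowE.
have -> : row i (c *: P) = c *: row i P by apply/rowP => l; rewrite !mxE.
(* Freeness kills the coefficient [P i i * s i j] of row j; the scalar [c] only affects the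
   coefficient of row i. *)
move=> /eqP; rewrite -subr_eq0 -addrA -scalerBl addrC.
move=> /eqP/free[_ /eqP]; rewrite mulf_eq0 => /orP[|/eqP //].
apply: contraTeq => _; apply: projector_diag_neq0 => //.
apply/eqP => rowi0.
have [] := free 1 0; first by rewrite rowi0 scaler0 scale0r addr0.
by move/eqP; rewrite oner_eq0.
Qed.

(** With [Q] the rows of the identity indexed by [W], the projector is [Q ^t* *m Q], and
    [Q *m s *m Q ^t*] is the submatrix of [s] on [W]. *)
Lemma coord_projector (R : realType) n (W : {set 'I_n}) :
  exists P : 'M[R[i]]_n, [/\ projector P, \rank P = #|W| &
    forall s : 'M_n, (forall i j, i \in W -> j \in W -> s i j = 0) ->
      P *m s *m P = 0].
Proof.
pose Q := rowsub (fun u : 'I_#|W| => enum_val u) (1%:M : 'M[R[i]]_n).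
have QQ : Q *m Q ^t* = 1%:M.
  apply/matrixP => u v; rewrite /Q mul_rowsub_mx mul1mx !mxE.
  by rewrite rmorph_nat (inj_eq enum_val_inj) eq_sym.
have uQ : Q \is unitarymx by apply/unitarymxP.
exists (Q ^t* *m Q); split.
- split; last by rewrite mulmxA -[_ *m _ *m Q^t*]mulmxA QQ mulmx1.
  by rewrite trmx_mul map_mxM trmxCK.
- rewrite mxrankMfree; last by rewrite /row_free mxrank_unitary.
  by rewrite mxrank_map mxrank_tr mxrank_unitary.
- move=> s s0; suff QsQ : Q *m s *m Q ^t* = 0.
    by rewrite -!mulmxA [s *m _]mulmxA ![Q *m _]mulmxA QsQ mul0mx mulmx0.
  apply/matrixP => u v; rewrite /Q mul_rowsub_mx mul1mx.
  rewrite !mxE (bigD1 (enum_val v)) //= big1 ?addr0.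
    by rewrite !mxE eqxx s0 ?mul0r // enum_valP.
  by move=> k /negbTE kv; rewrite !mxE [_ == k]eq_sym kv rmorph0 mulr0.
Qed.

(** * The two inequalities *)

Lemma quantum_to_classical (R : realType) n (A C : 'M[R[i]]_n) k P :
  (forall i, A i i = 0) -> (forall i, C i i = 0) ->
  quantum_independent_set (X_AC A C) k P ->
  exists2 W, independent_set (strange_graph_of A C) W & #|W| = k.
Proof.
move=> A0 C0 [projP <- hP]; pose f := maxrankfun P.
exists (f @: setT); last first.
  by rewrite card_imset ?cardsT ?card_ord //; exact: maxrankfun_inj.
move=> _ _ /imsetP[u _ ->] /imsetP[v _ ->] /adjacent_coefs[fuv].
have uv : u != v by apply: contraNneq fuv => ->.
(* The test element is the realignment of a matrix unit: its entry at [(f u, f v)] is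
   [A (f v) (f u)], which adjacency makes nonzero. *)
have [c hc] := hP _ (ex_intro _ (delta_mx (f u) (f v)) erefl).
apply/negP; rewrite negbK; apply/eqP.
have := independent_rows_coef projP fuv _ _ hc.
rewrite realignment_X_AC // !mxE !eqxx mulr1 (negbTE fuv) andbF mulr0 addr0.
apply.
- move=> a b ab0.
  have /(row_free_inj (maxrowsub_free P)) :
      (a *: delta_mx 0 u + b *: delta_mx 0 v : 'rV_ _) *m rowsub f P
      = 0 *m rowsub f P.
    rewrite mulmxDl -!scalemxAl -!rowE mul0mx -[RHS]ab0.
    by congr (_ *: _ + _ *: _); apply/rowP => l; rewrite !mxE.
  move=> /rowP e; have := e u; have := e v.
  rewrite !mxE !eqxx [v == u]eq_sym (negbTE uv) !mulr1 !mulr0.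
  by rewrite addr0 add0r.
- move=> i j; rewrite realignment_X_AC // !mxE => /eqP.
  have [/andP[/eqP-> /eqP->]|_] := boolP ((i == _) && _); first by left.
  have [/andP[/eqP-> /eqP->]|_] := boolP ((j == _) && _); first by right.
  by rewrite !mulr0 addr0.
Qed.

Lemma classical_to_quantum (R : realType) n (A C : 'M[R[i]]_n) W :
  (forall i, A i i = 0) -> (forall i, C i i = 0) ->
  simple_quantum_graph (X_AC A C) ->
  independent_set (strange_graph_of A C) W ->
  exists P, quantum_independent_set (X_AC A C) #|W| P.
Proof.
move=> A0 C0 G hW; have [P [projP rkP hP]] := coord_projector R W.
exists P; split=> // _ [x ->]; exists 0; rewrite scale0r.
apply: hP => i j iW jW.
rewrite realignment_X_AC //; have [<-|ij] := eqVneq i j.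
  by rewrite A0 C0 !mul0r addr0.
(* The entry at [(i, j)] involves [C i j] and [A j i], so non-adjacency is used in both orders. *)
have [_ ->] := nonadjacent_coefs A0 C0 G ij (hW _ _ iW jW).
have ji : j != i by rewrite eq_sym.
have [-> _] := nonadjacent_coefs A0 C0 G ji (hW _ _ jW iW).
by rewrite !mul0r addr0.
Qed.

Theorem proposition4p27 (R : realType) (n : nat) (A C : 'M[complex R]_n) :
  (2 <= n)%N ->
  (forall i, A i i = 0%R) -> (forall i, C i i = 0%R) ->
  simple_quantum_graph (X_AC A C) ->
  quantum_independence_number (X_AC A C)
    = independence_number (strange_graph_of A C).
Proof.
move=> _ A0 C0 G; apply/eqP; rewrite eqn_leq; apply/andP; split.
  apply/bigmax_leqP => k /asboolP[P /(quantum_to_classical A0 C0)[W hW <-]].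
  by apply: (@bigop.bigmax_sup _ W) => //; apply/asboolP.
apply/bigmax_leqP => W /asboolP/(classical_to_quantum A0 C0 G) hP.
(* The size of [W] has to be one of the ranks over which the quantum maximum ranges. *)
have ltW : (#|W| < n.+1)%N by rewrite ltnS -[X in (_ <= X)%N]card_ord max_card.
by apply: (@bigop.bigmax_sup _ (Ordinal ltW)) => //; apply/asboolP.
Qed.
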